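(* Let $n$ be a positive integer and $\mathbb{Z}_n=\mathbb{Z}/n\mathbb{Z}$. If $n$ is odd, then $\mathrm{Quad}(\mathbb{Z}_n,\mathbb{R}/\mathbb{Z})$ is a cyclic group of order $n$, with generator given by $q_n:\mathbb{Z}_n\to\mathbb{R}/\mathbb{Z}$, $m\mapsto m^2/n$. If $n$ is even, then $\mathrm{Quad}(\mathbb{Z}_n,\mathbb{R}/\mathbb{Z})$ is a cyclic group of order $2n$, with generator given by $q_{2n}:\mathbb{Z}_n\to\mathbb{R}/\mathbb{Z}$, $m\mapsto m^2/(2n)$.
   Context: For abelian groups $A,B$, a quadratic form from $A$ to $B$ is a function $\gamma:A\to B$ such that $\gamma(a)=\gamma(-a)$ and $\gamma(a+b+c)-\gamma(b+c)-\gamma(a+c)-\gamma(a+b)+\gamma(a)+\gamma(b)+\gamma(c)=0$ for all $a,b,c\in A$. $\mathrm{Quad}(A,B)$ is the group of all quadratic forms from $A$ to $B$ under pointwise addition. *)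

(* Defs.v *)
From HB Require Import structures.
From mathcomp Require Import all_boot all_order all_algebra.
From mathcomp Require Import generic_quotient ring_quotient.
From mathcomp Require Import boolp classical_sets functions cardinality reals.

Set Implicit Arguments.
Unset Strict Implicit.
Unset Printing Implicit Defensive.

Import GRing.Theory Num.Theory.
Local Open Scope ring_scope.
Local Open Scope classical_set_scope.
Local Open Scope card_scope.
Local Open Scope quotient_scope.

Section Quad.
Variables A B : zmodType.

Definition quadratic_form (f : A -> B) : Prop :=
  (forall a, f a = f (- a)) /\
  (forall a b c, f (a + b + c) - f (b + c) - f (a + c) - f (a + b)
                 + f a + f b + f c = 0).

Definition quad_pred : {pred A -> B} := [pred f | `[< quadratic_form f >]].

Lemma quad_pred_zmod_closed : zmod_closed quad_pred.
Proof.
split=> [|f g /asboolP[fN fD] /asboolP[gN gD]]; apply/asboolP; split=> //=.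
- by move=> a b c; rewrite !subr0 !addr0.
- by move=> a; rewrite !fctE fN gN.
move=> a b c; rewrite !fctE.
have subD (x y z t : B) : (x - y) + (z - t) = (x + z) - (y + t).
  by rewrite addrACA -opprD.
have subB (x y z t : B) : (x - y) - (z - t) = (x - z) - (y - t).
  by rewrite !opprB !subD (addrC y).
rewrite (subB (f _)) (subB (f _ - _)) (subB (f _ - _ - _)).
rewrite (subD (f _ - _ - _ - _)) (subD (f _ - _ - _ - _ + _)).
by rewrite (subD (f _ - _ - _ - _ + _ + _)) fD gD subr0.
Qed.

HB.instance Definition _ :=
  GRing.isZmodClosed.Build (A -> B) quad_pred quad_pred_zmod_closed.

(* The group Quad(A, B): the group law is the one of A -> B, i.e. pointwise. *)
Record Quad := MkQuad { quad_val :> A -> B; _ : quad_val \in quad_pred }.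

HB.instance Definition _ := [isSub for quad_val].
HB.instance Definition _ := [Choice of Quad by <:].
HB.instance Definition _ := [SubChoice_isSubZmodule of Quad by <:].

End Quad.

(* Num.int_num_subdef is the predicate underlying Num.int. *)
Definition int_subgroup (R : realType) : zmodClosed R :=
  GRing.ZmodClosed.clone R (@Num.int_num_subdef R) _.

(* R / Z as an additive group; no ring structure is involved, despite the
   notation. *)
Definition RmodZ (R : realType) : zmodType := {ideal_quot (int_subgroup R)}.

Definition to_RmodZ (R : realType) (x : R) : RmodZ R :=
  \pi_{ideal_quot (int_subgroup R)} x.

(* The class of m in Z / n.+1 Z; the ring structure of 'I_n.+1 is only
   available for n > 0, hence the use of Zp1 instead of 1. *)
Definition class_mod (n : nat) (m : int) : 'I_n.+1 := Zp1 *~ m.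

Definition cyclic_of_order (G : zmodType) (N : nat) (g : G) : Prop :=
  [set: G] #= `I_N /\ (forall x : G, exists k : int, x = g *~ k).

(* Main.v *)
(** A quadratic form satisfies [f (m a) = m^2 f a], so a form on Z/N is
    determined by [t := f 1].  Comparing the values at [0] and [N], and at [1]
    and [N + 1], gives [N^2 t = 0] and [2 N t = 0], i.e. [M t = 0] for
    [M := gcd (2 N, N^2)]; conversely [m |-> m^2 / M] is well defined mod 1 and
    takes at [1] the value [1 / M], which generates the M-torsion of R/Z.
    Finally [M = N] if [N] is odd and [M = 2 N] if [N] is even. *)
Require Import Defs.
From HB Require Import structures.
From mathcomp Require Import all_boot all_order all_algebra.
From mathcomp Require Import generic_quotient ring_quotient.
From mathcomp Require Import boolp classical_sets functions cardinality.
From mathcomp Require Import reals.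
From mathcomp Require Import ring zify.

Import GRing.Theory Num.Theory.
Local Open Scope ring_scope.

Section QuadraticForm.
Variables (A B : zmodType) (f : A -> B).
Hypothesis qf : quadratic_form f.

Lemma quadratic_form0 : f 0 = 0.
Proof.
have [_ /(_ 0 0 0)] := qf.
by rewrite !addr0 subrr !sub0r subrK addNr add0r.
Qed.

(** This is the defining cubic identity at [(a, b, - b)], simplified by evenness and [f 0 = 0]. *)
Lemma quadratic_form_parallelogram a b :
  f (a + b) + f (a - b) = f a *+ 2 + f b *+ 2.
Proof.
have [fN /(_ a b (- b))] := qf.
rewrite addrK subrr quadratic_form0 subr0 -fN => H.
apply/esym/eqP; rewrite -subr_eq0 -[X in _ == X]H opprD !mulr2n.
by rewrite (AC (2*2*2) (1*6*5*2*3*4))/=.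
Qed.

Lemma quadratic_formMz a (m : int) : f (a *~ m) = f a *~ (m ^+ 2).
Proof.
have [fN _] := qf.
have pos (k : nat) : f (a *+ k) = f a *~ (k%:Z ^+ 2).
  (* The parallelogram law at [a *+ k.+1] and [a] is a two-step recurrence, so the induction carries
     two consecutive values. *)
  suff: f (a *+ k) = f a *~ (k%:Z ^+ 2)
        /\ f (a *+ k.+1) = f a *~ (k.+1%:Z ^+ 2) by case.
  elim: k => [|k [IH1 IH2]]; first by rewrite quadratic_form0.
  split=> //.
  have := quadratic_form_parallelogram (a *+ k.+1) a.
  rewrite -mulrSr [in a *+ k.+1 - a]mulrSr addrK IH1 IH2.
  move/(canRL (addrK _)) => ->.
  rewrite -[_ *+ 2]/(_ *~ 2) -[f a *+ 2]/(f a *~ 2) -mulrzA -mulrzDr -mulrzBr.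
  by congr (_ *~ _); lia.
case: m => k; first exact: pos.
by rewrite NegzE mulrNz -fN pos sqrrN.
Qed.

End QuadraticForm.

(** Evaluation gets a name so that it can carry an additive morphism structure, which then commutes
    with integer multiples. *)
Definition quad_eval (A B : zmodType) (x : A) (f : Quad A B) : B := f x.

Lemma quad_eval_is_zmod_morphism (A B : zmodType) (x : A) :
  zmod_morphism (@quad_eval A B x).
Proof. by []. Qed.

HB.instance Definition _ (A B : zmodType) (x : A) :=
  GRing.isZmodMorphism.Build (Quad A B) B (@quad_eval A B x)
    (quad_eval_is_zmod_morphism A B x).

Lemma quad_Mz (A B : zmodType) (f : Quad A B) (k : int) (x : A) :
  (f *~ k) x = f x *~ k.
Proof. exact: (raddfMz (@quad_eval A B x)). Qed.

Lemma to_RmodZ_is_zmod_morphism (R : realType) : zmod_morphism (@to_RmodZ R).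
Proof. exact: raddfB. Qed.

HB.instance Definition _ (R : realType) :=
  GRing.isZmodMorphism.Build R (RmodZ R) (@to_RmodZ R)
    (to_RmodZ_is_zmod_morphism R).

Lemma to_RmodZ_eq0 (R : realType) (x : R) :
  to_RmodZ x = 0 <-> exists k : int, x = k%:~R.
Proof.
rewrite -(raddf0 (@to_RmodZ R)); split=> [/eqP|[k ->]].
  by rewrite -Quotient.idealrBE subr0 => /intrP.
by apply/eqP; rewrite -Quotient.idealrBE subr0; apply/intrP; exists k.
Qed.

Lemma to_RmodZ_surj (R : realType) (t : RmodZ R) : exists x, t = to_RmodZ x.
Proof. by exists (repr t); rewrite /to_RmodZ reprK. Qed.

Lemma class_modD (n : nat) : {morph class_mod n : k m / k + m}.
Proof. by move=> k m; rewrite /class_mod mulrzDr. Qed.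

Lemma class_modN (n : nat) : {morph class_mod n : m / - m}.
Proof. by move=> m; rewrite /class_mod mulrNz. Qed.

Lemma class_mod_val (n : nat) (x : 'I_n.+1) : class_mod n (val x) = x.
Proof.
by rewrite /class_mod -pmulrn Zp_mulrn; apply: val_inj;
  rewrite /= modnMml mul1n modn_small.
Qed.

Lemma class_mod_eq0 (n : nat) (m : int) :
  class_mod n m = 0 <-> (n.+1%:Z %| m)%Z.
Proof.
have pos (k : nat) : @Zp1 n *+ k = 0 <-> (n.+1 %| k)%N.
  rewrite Zp_mulrn; split=> [[]|/eqP k0].
    by rewrite modnMml mul1n => /eqP.
  by apply: val_inj; rewrite /= modnMml mul1n.
rewrite /class_mod dvdzE /=; case: m => k; first exact: pos.
rewrite NegzE mulrNz abszN -pos -pmulrn; split=> [/eqP|->]; last exact: oppr0.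
by rewrite oppr_eq0 => /eqP.
Qed.

(** Euclidean division by [N] reduces each multiple of [g] to one with coefficient below [N]; two
    such coefficients giving the same element are congruent mod [N], hence equal. *)
Lemma cyclic_of_orderP (G : zmodType) (N : nat) (g : G) :
  (0 < N)%N -> (forall k : int, g *~ k = 0 <-> (N %| k)%Z) ->
  (forall x, exists k : int, x = g *~ k) -> cyclic_of_order N g.
Proof.
move=> N0 gN gen; split=> //.
have -> : [set: G]%classic = ((fun i : nat => g *+ i) @` `I_N)%classic.
  apply/seteqP; split=> // x _; have [k ->] := gen x.
  have rE : `|(k %% N)%Z|%N = (k %% N)%Z :> int.
    by rewrite gez0_abs // modz_ge0 // -lt0n.
  exists `|(k %% N)%Z|%N; first by rewrite /= -ltz_nat rE ltz_pmod.
  rewrite pmulrn rE [in RHS](divz_eq k N) [RHS]mulrzDr.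
  by rewrite (proj2 (gN (_ * _))) ?add0r // dvdz_mull.
apply: inj_card_eq => i j /set_mem /= iN /set_mem /= jN gij.
have: g *~ (i%:Z - j%:Z) = 0 by rewrite mulrzBr -!pmulrn gij subrr.
move=> /gN; rewrite -eqz_mod_dvd !modz_nat eqz_nat !modn_small //.
by move=> /eqP.
Qed.

(** Keeping [M] as a gcd treats both parities at once. *)
Lemma quad_Zn_cyclic (R : realType) (n M : nat) :
  M = gcdn (2 * n.+1) (n.+1 ^ 2) ->
  exists q : Quad 'I_n.+1 (RmodZ R),
    (forall m : int, q (class_mod n m) = to_RmodZ (m%:~R ^+ 2 / M%:R)) /\
    cyclic_of_order M q.
Proof.
move=> ME; have M0 : (0 < M)%N by rewrite ME gcdn_gt0.
have MR : M%:R != 0 :> R by rewrite pnatr_eq0 -lt0n.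
have M2N : (M %| 2 * n.+1)%N by rewrite ME dvdn_gcdl.
have MNN : (M %| n.+1 ^ 2)%N by rewrite ME dvdn_gcdr.
(* The form is defined on the representatives [0, ..., n]; [gE] then shows that any integer
   representative gives the same value. *)
pose g (x : 'I_n.+1) : RmodZ R := to_RmodZ ((val x)%:R ^+ 2 / M%:R).
have gE (m : int) : g (class_mod n m) = to_RmodZ (m%:~R ^+ 2 / M%:R).
  set x := class_mod n m.
  have /class_mod_eq0/dvdzP[k mk] : class_mod n (m - (val x)%:Z) = 0.
    by rewrite class_modD class_modN class_mod_val subrr.
  have {mk} -> : m = (val x)%:Z + k * n.+1%:Z by rewrite -mk addrC subrK.
  have /dvdnP[c cE] := M2N; have /dvdnP[d dE] := MNN.
  (* With [N = n.+1], the difference is [2 N x k + N^2 k^2], where [2 N = c M] and [N^2 = d M]. *)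
  have E : ((val x)%:Z + k * n.+1%:Z) ^+ 2 - (val x)%:Z ^+ 2
           = ((val x)%:Z * k * c%:Z + k ^+ 2 * d%:Z) * M%:Z.
    have c' : 2 * n.+1%:Z = c%:Z * M by rewrite -!PoszM cE.
    have d' : n.+1%:Z ^+ 2 = d%:Z * M by rewrite -PoszM -dE.
    by rewrite mulrDl -!mulrA -c' -d'; ring.
  apply/esym/eqP; rewrite -subr_eq0 -raddfB; apply/eqP/to_RmodZ_eq0.
  exists ((val x)%:Z * k * c%:Z + k ^+ 2 * d%:Z).
  by rewrite -mulrBl pmulrn -!rmorphXn -rmorphB E rmorphM /= mulfK.
have gQ : g \in @quad_pred 'I_n.+1 (RmodZ R).
  apply/asboolP; split=> [a|a b c].
    by rewrite -[a]class_mod_val -class_modN !gE mulrNz sqrrN.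
  (* On integer lifts, the cubic identity for [m^2 / M] already holds in [R], before reduction mod
     1. *)
  rewrite -[a]class_mod_val -[b]class_mod_val -[c]class_mod_val.
  rewrite -!class_modD !gE.
  rewrite -!(raddfB (@to_RmodZ R), raddfD (@to_RmodZ R)) -[RHS](raddf0 (@to_RmodZ R)); congr to_RmodZ.
  by rewrite !rmorphD /=; field.
have gkE (k m : int) :
    (MkQuad gQ *~ k) (class_mod n m) = to_RmodZ ((m ^+ 2 * k)%:~R / M%:R).
  rewrite quad_Mz /= gE -raddfMz -mulrzr rmorphM rmorphXn /=.
  by congr to_RmodZ; rewrite mulrAC.
exists (MkQuad gQ); split; first exact: gE.
apply: cyclic_of_orderP => // [k|f].
  split=> [k0|/dvdzP[j kE]].
    (* Evaluating at the class of 1 makes [k / M] an integer. *)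
    have := gkE k 1; rewrite k0 expr1n mul1r => /esym/to_RmodZ_eq0[j].
    move=> /(canRL (divfK MR)); rewrite [M%:R]pmulrn -rmorphM => /intr_inj ->.
    exact: dvdz_mull.
  apply: val_inj; apply/funext => x; rewrite -[x]class_mod_val [LHS]gkE.
  apply/to_RmodZ_eq0; exists ((val x)%:Z ^+ 2 * j).
  by rewrite kE mulrA [in LHS]rmorphM mulfK.
have /asboolP qf : quad_val f \in @quad_pred _ _ := valP f.
have fE m : f (class_mod n m) = f Zp1 *~ m ^+ 2 by apply: quadratic_formMz.
have class_mod_n : class_mod n n.+1 = 0 by apply/class_mod_eq0.
have tNN : f Zp1 *~ n.+1%:Z ^+ 2 = 0.
  by rewrite -fE class_mod_n quadratic_form0.
have t2N : f Zp1 *~ (2 * n.+1%:Z) = 0.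
  have : f Zp1 *~ (n.+1%:Z + 1) ^+ 2 = f Zp1.
    by rewrite -fE class_modD class_mod_n add0r.
  rewrite sqrrD expr1n mulr1 -mulr_natl 2!mulrzDr tNN add0r mulr1z.
  by move/(canRL (addrK _)); rewrite subrr.
have tM : f Zp1 *~ M = 0.
  (* [M] is an integer combination of two annihilators of [f Zp1]. *)
  have [u [v uv]] := Bezoutz (2 * n.+1%:Z) (n.+1%:Z ^+ 2).
  have -> : M%:Z = u * (2 * n.+1%:Z) + v * n.+1%:Z ^+ 2 by rewrite uv ME.
  rewrite mulrzDr (mulrC u) (mulrC v) mulrzA t2N mul0rz add0r mulrzA tNN.
  exact: mul0rz.
(* For a real lift [r] of [f Zp1], the product [r M] is an integer [k]; so [f Zp1] is the class of
   [k / M], and [f] is [k] times the generator. *)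
have [r tE] := to_RmodZ_surj _ (f Zp1).
have [k rk] : exists k : int, r * M%:R = k%:~R.
  by apply/to_RmodZ_eq0; rewrite -[RHS]tM tE pmulrn mulrzr; apply: raddfMz.
exists k; apply: val_inj; apply/funext => x; rewrite -[x]class_mod_val.
rewrite [LHS]fE [RHS]gkE tE -raddfMz; congr to_RmodZ.
by rewrite intrM -rk mulrA mulfK // mulrzl.
Qed.

Theorem proposition4p1 (R : realType) (n : nat) :
  (odd n.+1 ->
    exists q : Quad 'I_n.+1 (RmodZ R),
      (forall m : int, q (class_mod n m) = to_RmodZ (m%:~R ^+ 2 / n.+1%:R)) /\
      cyclic_of_order n.+1 q) /\
  (~~ odd n.+1 ->
    exists q : Quad 'I_n.+1 (RmodZ R),
      (forall m : int,
         q (class_mod n m) = to_RmodZ (m%:~R ^+ 2 / (2 * n.+1)%N%:R)) /\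
      cyclic_of_order (2 * n.+1)%N q).
Proof.
split=> n_parity; apply: quad_Zn_cyclic;
  (* The gcd factors as [gcdn 2 n.+1 * n.+1], and parity decides the first factor. *)
  rewrite expnS expn1 -muln_gcdl.
  by have/eqP -> : coprime 2 n.+1; rewrite ?mul1n // coprime2n.
by have/gcdn_idPl -> : (2 %| n.+1)%N by rewrite dvdn2.
Qed.
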